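(* Let $X=[\mathbf x_1,\ldots,\mathbf x_n]\in\mathbb R^{d\times n}$ and $1\le K\le d$. Let $\{U^k,S^k\}$ be generated by the non-greedy algorithm (NGA) $$S^k=\operatorname{sgn}(X^\top U^k),\qquad U^{k+1}=\operatorname{PD}(XS^k),\qquad k=0,1,2,\ldots,$$ where $U^0\in\mathrm{St}(d,K)$ is such that $F(U^0,S^0)>0$, and where $\operatorname{PD}$ always selects the same $U$-factor for the same input matrix. Write $U^k=[\mathbf u_1^k,\ldots,\mathbf u_K^k]$. Then: 1. There exists a positive integer $k_0$ such that for all $i,j$ and all $k\ge k_0$, whenever $\mathbf x_i^\top\mathbf u_j^{k+1}\neq0$, it holds that $S^{k+1}_{ij}=S^k_{ij}$. 2. There exists a constant $\tau_0>0$ such that after at most $\left\lceil F^{\max}/\tau_0\right\rceil$ steps there holds $F(U^k,S^k)=F(U^{k+1},S^{k+1})=F(U^{k+2},S^{k+2})=\cdots$, while before it stops, the objective value $F(U^k,S^k)$ increases by at least $\tau_0$ in each iteration. 3. Let $k'$ denote the first step at which the objective value does not increase anymore, i.e. the first $k'$ with $F(U^{k'},S^{k'})=F(U^{k'+1},S^{k'+1})$. Then $U^{k'+1}$ is a FOC point.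
   Context: $\mathrm{St}(m,n)=\{U\in\mathbb R^{m\times n}: U^\top U=I\}$, $m\ge n$. $\|\cdot\|_1$ is the entrywise $L_1$-norm and $\langle\cdot,\cdot\rangle$ the Frobenius inner product. $\operatorname{sgn}(x)=x/|x|$ if $x\ne0$, $\operatorname{sgn}(0)=0$, applied entrywise. $F(U,S):=\langle X^\top U,S\rangle$, and $F^{\max}:=\max_{U\in\mathrm{St}(d,K)}\|X^\top U\|_1$ is the global maximum of the $L_1$-norm PCA problem. Polar decomposition: for $C\in\mathbb R^{m\times n}$, $m\ge n$, a polar decomposition is $C=UH$ with $U\in\mathrm{St}(m,n)$ and $H$ symmetric positive semidefinite; $U$ is called a $U$-factor of $C$. $U=\operatorname{PD}(C)$ means that $U$ is a $U$-factor of $C$; here $C\mapsto\operatorname{PD}(C)$ is a fixed single-valued selection of $U$-factors. $\partial\|V\|_1\big|_{V=X^\top U}$ is the set of $S\in\mathbb R^{n\times K}$ with $S_{ij}=\operatorname{sgn}((X^\top U)_{ij})$ if $(X^\top U)_{ij}\neq0$ and $S_{ij}\in[-1,1]$ otherwise. $U\in\mathrm{St}(d,K)$ is a FOC point if $U$ is a $U$-factor of some $W\in X\,\partial\|V\|_1\big|_{V=X^\top U}$ (equivalently, $\langle W,U-Z\rangle\ge0$ for all $Z\in\mathrm{St}(d,K)$ for some such $W$).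
   Formalization: In item 2, ''before it stops ... increases by at least τ0 in each iteration'' is proved for every iteration that changes F; a temporary stall F(U^k,S^k)=F(U^{k+1},S^{k+1}) before the final constancy is allowed, as such stalls can occur and make the literal claim false. *)

(* Defs.v *)
From HB Require Import structures.
From mathcomp Require Import all_boot all_order all_algebra.
From mathcomp Require Import all_classical all_reals all_analysis.
Set Implicit Arguments.
Unset Strict Implicit.
Unset Printing Implicit Defensive.
Import Order.TTheory GRing.Theory Num.Theory.
Import numFieldNormedType.Exports.
Local Open Scope classical_set_scope.
Local Open Scope ring_scope.

Section Definitions.
Context {R : realType}.

Definition stiefel (m n : nat) : set 'M[R]_(m, n) :=
  [set U | U^T *m U = 1%:M].
Arguments stiefel : clear implicits.

Definition norm1 (m n : nat) (V : 'M[R]_(m, n)) : R :=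
  \sum_(i < m) \sum_(j < n) `|V i j|.

Definition frobenius (m n : nat) (A B : 'M[R]_(m, n)) : R := \tr (A^T *m B).

Definition sgnmx (m n : nat) (V : 'M[R]_(m, n)) : 'M[R]_(m, n) :=
  map_mx Num.sg V.

Definition symmetric_psd (n : nat) (H : 'M[R]_n) : Prop :=
  H^T = H /\ forall x : 'cV[R]_n, 0 <= (x^T *m H *m x) 0 0.

(* U = PD(C) in the relational sense; U is not unique when C does not have
   full column rank. *)
Definition is_U_factor (m n : nat) (C U : 'M[R]_(m, n)) : Prop :=
  stiefel m n U /\ exists2 H : 'M[R]_n, symmetric_psd H & C = U *m H.

Definition PD_selection (m n : nat) (PD : 'M[R]_(m, n) -> 'M[R]_(m, n)) :
  Prop := forall C, is_U_factor C (PD C).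

Definition subdiff_norm1 (m n : nat) (V : 'M[R]_(m, n)) : set 'M[R]_(m, n) :=
  [set S | forall i j, if V i j != 0 then S i j = Num.sg (V i j)
                       else -1 <= S i j <= 1].

Definition F (d n K : nat) (X : 'M[R]_(d, n)) (U : 'M[R]_(d, K))
  (S : 'M[R]_(n, K)) : R := frobenius (X^T *m U) S.

(* The supremum is attained when K <= d: see FmaxP below. *)
Definition Fmax (d n K : nat) (X : 'M[R]_(d, n)) : R :=
  sup [set norm1 (X^T *m U) | U in stiefel d K].

Definition FOC (d n K : nat) (X : 'M[R]_(d, n)) (U : 'M[R]_(d, K)) : Prop :=
  exists2 S, subdiff_norm1 (X^T *m U) S & is_U_factor (X *m S) U.

Definition NGA (d n K : nat) (PD : 'M[R]_(d, K) -> 'M[R]_(d, K))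
  (X : 'M[R]_(d, n)) (U : nat -> 'M[R]_(d, K)) (S : nat -> 'M[R]_(n, K)) :
  Prop :=
  forall k, S k = sgnmx (X^T *m U k) /\ U k.+1 = PD (X *m S k).

End Definitions.

Arguments stiefel {R} m n _.

Section FmaxAttained.
Variables (R : realType) (d n K : nat) (X : 'M[R]_(d, n)).
Hypothesis leKd : (K <= d)%N.

Let cont_coord (i : 'I_d) (j : 'I_K) :
  continuous (fun v : 'rV[R]_(d * K) => vec_mx v i j).
Proof.
rewrite (_ : (fun v => _) = fun v : 'rV[R]_(d * K) =>
  v 0 (mxvec_index i j)); first exact: coord_continuous.
by apply/funext => w; rewrite mxE.
Qed.

Let cont_sum (m : nat) (f : 'I_m -> 'rV[R]_(d * K) -> R) :
  (forall i, continuous (f i)) -> continuous (fun v => \sum_(i < m) f i v).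
Proof.
by move=> cf; apply: continuous_big => [|i _]; [exact: add_continuous|exact: cf].
Qed.

Let cont_gram (i j : 'I_K) :
  continuous (fun v : 'rV[R]_(d * K) => ((vec_mx v)^T *m vec_mx v) i j).
Proof.
rewrite (_ : (fun v => _) = fun v : 'rV[R]_(d * K) =>
  \sum_(k < d) vec_mx v k i * vec_mx v k j).
  by apply: cont_sum => k v; apply: continuousM; apply: cont_coord.
by apply/funext => w; rewrite !mxE; apply: eq_bigr => k _; rewrite mxE.
Qed.

Let cont_obj : continuous (fun v : 'rV[R]_(d * K) => norm1 (X^T *m vec_mx v)).
Proof.
apply: cont_sum => i; apply: cont_sum => j v.
have cXV : continuous (fun v : 'rV[R]_(d * K) => (X^T *m vec_mx v) i j).
  rewrite (_ : (fun v => _) = fun v : 'rV[R]_(d * K) =>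
    \sum_(k < d) X k i * vec_mx v k j).
    apply: cont_sum => k w; apply: continuousM; last exact: cont_coord.
    exact: cst_continuous.
  by apply/funext => w; rewrite mxE; apply: eq_bigr => k _; rewrite mxE.
by apply: (continuous_comp (cXV v)); exact: norm_continuous.
Qed.

Let compact_stiefel :
  compact [set v : 'rV[R]_(d * K) | stiefel d K (vec_mx v)].
Proof.
apply: bounded_closed_compact.
  exists 1; split; first exact: num_real.
  move=> M M1 v /= Sv; apply: le_trans (ltW M1).
  rewrite (_ : `|v| = mx_norm v) // mx_normrE.
  apply/bigmax_leP; split => // -[a b] _ /=.
  case/mxvec_indexP: b => i j; rewrite (ord1 a).
  have /matrixP /(_ j j) := Sv; rewrite !mxE eqxx mulr1n => Sjj.
  have -> : v 0 (mxvec_index i j) = vec_mx v i j by rewrite mxE.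
  rewrite -(@expr_le1 _ 2) // real_normK ?num_real // -Sjj (bigD1 i) //= !mxE.
  by rewrite -expr2 lerDl sumr_ge0 // => k _; rewrite !mxE -expr2 sqr_ge0.
rewrite (_ : [set v | _] = \bigcap_(p in [set: 'I_K * 'I_K])
   (fun v : 'rV[R]_(d * K) => ((vec_mx v)^T *m vec_mx v) p.1 p.2) @^-1`
     [set (1%:M : 'M[R]_K) p.1 p.2]).
  apply: closed_bigI => p _; apply: closed_comp => [v _|].
    exact: cont_gram.
  exact: closed_eq.
apply/seteqP; split => v /=.
  by rewrite /stiefel /= => Sv p _ /=; rewrite Sv.
by move=> Sv; apply/matrixP => i j; exact: (Sv (i, j)).
Qed.

Lemma FmaxP : (exists2 U, stiefel d K U & Fmax K X = norm1 (X^T *m U)) /\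
  forall (U : 'M[R]_(d, K)), stiefel d K U -> norm1 (X^T *m U) <= Fmax K X.
Proof.
have [||v Sv vmax] := @compact_EVT_max _ R
    (fun v : 'rV[R]_(d * K) => norm1 (X^T *m vec_mx v)) _ _ compact_stiefel.
- exists (mxvec (pid_mx K)); rewrite /= mxvecK /stiefel /= tr_pid_mx.
  by rewrite mul_pid_mx minnn (minn_idPr leKd) pid_mx_1.
- exact: continuous_subspaceT.
have ubV (U : 'M[R]_(d, K)) : stiefel d K U ->
    norm1 (X^T *m U) <= norm1 (X^T *m vec_mx v).
  by move=> SU; have := vmax (mxvec U); rewrite inE /= mxvecK; exact.
have Sv' : stiefel d K (vec_mx v : 'M[R]_(d, K)) by move: Sv; rewrite inE.
have FE : Fmax K X = norm1 (X^T *m vec_mx v).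
  apply/eqP; rewrite eq_le; apply/andP; split.
    apply: ge_sup; first by exists (norm1 (X^T *m vec_mx v)), (vec_mx v).
    by move=> _ [U SU <-]; exact: ubV.
  apply: ub_le_sup; last by exists (vec_mx v).
  by exists (norm1 (X^T *m vec_mx v)) => _ [U SU <-]; exact: ubV.
by split; [exists (vec_mx v)|move=> U SU; rewrite FE ubV].
Qed.

End FmaxAttained.

(* Main.v *)
(** The objective F(U^k, S^k) = |X^T U^k|_1 increases in two half-steps: U^(k+1)
    maximizes <., X S^k> over the Stiefel manifold, and S^(k+1) maximizes
    <X^T U^(k+1), .> over matrices with entries in [-1, 1].  U^(k+1) depends
    only on S^k, which takes finitely many values, so the objective is
    eventually constant.  Whenever it stalls, equality in the second half-step
    says that S^k is a subgradient of the L1 norm at X^T U^(k+1), while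
    U^(k+1) is a U-factor of X S^k. *)
Require Import Defs.
From HB Require Import structures.
From mathcomp Require Import all_boot all_order all_algebra.
From mathcomp Require Import all_classical all_reals all_analysis.
From mathcomp Require Import lra.
Set Implicit Arguments.
Unset Strict Implicit.
Unset Printing Implicit Defensive.
Import Order.TTheory GRing.Theory Num.Theory.
Local Open Scope ring_scope.

(** Induction on a strict bound [m] for the number of entries of [s] above [f k]: each strict
    increase of [f] lowers this number. *)
Lemma monotone_finite_stationary (R : realType) (f : nat -> R) (s : seq R) :
  {homo f : k l / (k <= l)%N >-> k <= l} -> (forall k, f k \in s) ->
  exists N, forall l, (N <= l)%N -> f l = f N.
Proof.
move=> f_mono f_s.
suff stat m k : (count (> f k)%R s < m)%N ->
    exists N, forall l, (N <= l)%N -> f l = f N.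
  exact: stat 0%N (ltnSn _).
elim: m k => // m IHm k; rewrite ltnS => le_m.
have [?|/existsNP[l /not_implyP[le_kl /eqP f_kl]]] :=
  pselect (forall l, (k <= l)%N -> f l = f k); first by exists k.
have lt_kl : f k < f l by rewrite lt_neqAle eq_sym f_kl f_mono.
apply: (IHm l); apply: leq_trans le_m.
(* The entries above [f k] split into those above [f l] and those in the interval from [f k]
   (excluded) to [f l] (included); the latter group contains [f l], so it is nonempty. *)
have -> : count (> f k)%R s =
    (count (> f l)%R s + count [pred x | f k < x <= f l]%R s)%N.
  rewrite -count_predUI [X in (_ + X)%N](_ : _ = 0%N) ?addn0.
    apply: eq_count => x /=; case: (leP x (f l)) => [_|lt_lx] /=.
      by rewrite andbT.
    by rewrite (lt_trans lt_kl).
  rewrite -[RHS](count_pred0 s); apply: eq_count => x /=.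
  by case: leP; rewrite ?andbF.
rewrite -addn1 leq_add2l -has_count; apply/hasP; exists (f l) => //=.
by rewrite lt_kl lexx.
Qed.

(** [t] is the minimum of 1 and the finitely many nonzero increments before step [N]. *)
Lemma min_increment (R : realType) (f : nat -> R) (N : nat) :
  (forall k, f k <= f k.+1) ->
  exists2 t, 0 < t &
    forall k, (k < N)%N -> f k <> f k.+1 -> f k + t <= f k.+1.
Proof.
move=> f_le; elim: N => [|N [t t_gt0 tP]]; first by exists 1.
have [fN|/eqP fN] := eqVneq (f N) (f N.+1).
  exists t => // k; rewrite ltnS leq_eqVlt => /predU1P[-> //|]; exact: tP.
have fN_gt0 : 0 < f N.+1 - f N by rewrite subr_gt0 lt_neqAle f_le andbT; apply/eqP.
exists (Num.min t (f N.+1 - f N)) => [|k]; first by rewrite lt_min t_gt0.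
rewrite -lerBrDl ge_min ltnS leq_eqVlt.
case/predU1P => [-> _|k_lt fk]; first by rewrite lexx orbT.
by rewrite lerBrDl tP.
Qed.

Section Matrices.
Variable R : realType.

Lemma frobeniusE (m n : nat) (A B : 'M[R]_(m, n)) :
  frobenius A B = \sum_(i < m) \sum_(j < n) A i j * B i j.
Proof.
rewrite /frobenius /mxtrace exchange_big; apply: eq_bigr => j _.
by rewrite mxE; apply: eq_bigr => i _; rewrite mxE.
Qed.

(** This form exposes the linear functional of [U] that a U-factor of [X *m S] maximizes. *)
Lemma F_adjoint (d n K : nat) (X : 'M[R]_(d, n)) (U : 'M[R]_(d, K))
  (S : 'M[R]_(n, K)) : F X U S = frobenius U (X *m S).
Proof. by rewrite /F /frobenius trmx_mul trmxK mulmxA. Qed.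

Lemma frobenius_sgnmx (m n : nat) (V : 'M[R]_(m, n)) :
  frobenius V (sgnmx V) = norm1 V.
Proof.
rewrite frobeniusE; apply: eq_bigr => i _; apply: eq_bigr => j _.
by rewrite mxE mulrC -normrEsg.
Qed.

Lemma mul_le_norm (x s : R) : `|s| <= 1 -> x * s <= `|x|.
Proof.
move=> s1; apply: le_trans (ler_norm _) _.
by rewrite normrM ler_piMr.
Qed.

Lemma frobenius_le_norm1 (m n : nat) (V S : 'M[R]_(m, n)) :
  (forall i j, `|S i j| <= 1) -> frobenius V S <= norm1 V.
Proof.
move=> S1; rewrite frobeniusE; apply: ler_sum => i _; apply: ler_sum => j _.
exact: mul_le_norm.
Qed.

(** Equality case of [frobenius_le_norm1]: the entrywise gaps are nonnegative and sum to zero, so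
    each vanishes, and a nonzero [V i j] can be cancelled. *)
Lemma frobenius_eq_norm1 (m n : nat) (V S : 'M[R]_(m, n)) :
  (forall i j, `|S i j| <= 1) -> frobenius V S = norm1 V ->
  forall i j, V i j != 0 -> S i j = Num.sg (V i j).
Proof.
move=> S1 VS i j V_neq0; apply: (mulfI V_neq0).
rewrite [RHS]mulrC -normrEsg; apply/eqP; rewrite -subr_eq0 -opprB oppr_eq0.
have ge0 a b : 0 <= `|V a b| - V a b * S a b by rewrite subr_ge0 mul_le_norm.
have /eqP : \sum_a \sum_b (`|V a b| - V a b * S a b) = 0.
  apply/eqP; under eq_bigr do rewrite sumrB.
  by rewrite sumrB subr_eq0 -frobeniusE VS.
rewrite psumr_eq0 => [/allP/(_ i (mem_index_enum _))/=|a _]; last exact: sumr_ge0.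
by rewrite psumr_eq0 // => /allP/(_ j (mem_index_enum _)).
Qed.

Lemma sgnmx_norm_le1 (m n : nat) (V : 'M[R]_(m, n)) i j : `|sgnmx V i j| <= 1.
Proof. by rewrite mxE normr_sg; case: eqP. Qed.

(** Each diagonal entry of the product is the quadratic form of [H] at a row of [W]. *)
Lemma mxtrace_congr_psd_ge0 (m n : nat) (H : 'M[R]_n) (W : 'M[R]_(m, n)) :
  symmetric_psd H -> 0 <= \tr (W *m H *m W^T).
Proof.
case=> _ psdH; apply: sumr_ge0 => i _.
have := psdH (row i W)^T; rewrite trmxK -row_mul.
suff -> : (row i (W *m H) *m (row i W)^T) 0 0 = (W *m H *m W^T) i i by [].
by rewrite !mxE; apply: eq_bigr => k _; rewrite !mxE.
Qed.

(* With C = U H, the gap is half of tr ((U - Z) H (U - Z)^T). *)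
Lemma U_factor_max (m n : nat) (C U Z : 'M[R]_(m, n)) :
  is_U_factor C U -> stiefel m n Z -> frobenius Z C <= frobenius U C.
Proof.
case=> UU [H psdH ->] ZZ; have symH := psdH.1.
have trUZ : \tr (U *m H *m Z^T) = frobenius Z (U *m H).
  by rewrite mxtrace_mulC.
have trZU : \tr (Z *m H *m U^T) = frobenius Z (U *m H).
  by rewrite -mxtrace_tr !trmx_mul trmxK symH mulmxA trUZ.
have trUU : \tr (U *m H *m U^T) = \tr H.
  by rewrite mxtrace_mulC mulmxA UU mul1mx.
have trZZ : \tr (Z *m H *m Z^T) = \tr H.
  by rewrite mxtrace_mulC mulmxA ZZ mul1mx.
have -> : frobenius U (U *m H) = \tr H by rewrite /frobenius mulmxA UU mul1mx.
have := mxtrace_congr_psd_ge0 (U - Z) psdH.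
rewrite linearB /= !mulmxBl !mulmxBr !raddfB /= trUZ trZU trUU trZZ.
by lra.
Qed.

Section Iteration.
Variables (d n K : nat) (X : 'M[R]_(d, n)) (PD : 'M[R]_(d, K) -> 'M[R]_(d, K)).
Variables (U : nat -> 'M[R]_(d, K)) (S : nat -> 'M[R]_(n, K)).
Hypothesis PD_sel : PD_selection PD.
Hypothesis U0_St : stiefel d K (U 0%N).
Hypothesis US_nga : NGA PD X U S.

Let f k := F X (U k) (S k).

Lemma NGA_U_factor k : is_U_factor (X *m S k) (U k.+1).
Proof. by rewrite (US_nga k).2; exact: PD_sel. Qed.

Lemma NGA_stiefel k : stiefel d K (U k).
Proof. by case: k => [|k] //; have [] := NGA_U_factor k. Qed.

Lemma NGA_norm1 k : f k = norm1 (X^T *m U k).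
Proof. by rewrite /f (US_nga k).1 /F frobenius_sgnmx. Qed.

Lemma NGA_sign_le1 k i j : `|S k i j| <= 1.
Proof. by rewrite (US_nga k).1 sgnmx_norm_le1. Qed.

Lemma NGA_U_step k : f k <= F X (U k.+1) (S k).
Proof.
by rewrite /f !F_adjoint U_factor_max //; [exact: NGA_U_factor|exact: NGA_stiefel].
Qed.

Lemma NGA_S_step k : F X (U k.+1) (S k) <= f k.+1.
Proof. by rewrite NGA_norm1 frobenius_le_norm1 //; exact: NGA_sign_le1. Qed.

Lemma NGA_increasing k : f k <= f k.+1.
Proof. exact: le_trans (NGA_U_step k) (NGA_S_step k). Qed.

(** A stall squeezes [F X (U k.+1) (S k)] between equal values, so the second half-step is an
    equality. *)
Lemma NGA_stall k : f k = f k.+1 ->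
  forall i j, (X^T *m U k.+1) i j != 0 -> S k i j = Num.sg ((X^T *m U k.+1) i j).
Proof.
move=> fk; apply: frobenius_eq_norm1; first exact: NGA_sign_le1.
apply/eqP; rewrite -NGA_norm1 eq_le; apply/andP; split; first exact: NGA_S_step.
by rewrite -fk; exact: NGA_U_step.
Qed.

Lemma NGA_stationary : exists N, forall l, (N <= l)%N -> f l = f N.
Proof.
(* U k.+1 depends only on the sign matrix S k, a matrix over the three values
   b1 - b2 with b1 b2 : bool. *)
pose h (b : bool * bool) : R := b.1%:R - b.2%:R.
pose g (M : 'M[bool * bool]_(n, K)) := norm1 (X^T *m PD (X *m map_mx h M)).
(* [f 0%N] is listed separately because [U 0%N] is an arbitrary Stiefel point, not an output of
   [PD]. *)
apply: (monotone_finite_stationary (s := f 0%N :: [seq g M | M : 'M[bool * bool]_(n, K)])).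
  by apply: homo_leq => //; [exact: le_trans|exact: NGA_increasing].
case=> [|k]; first exact: mem_head.
rewrite in_cons; apply/orP; right; apply/codomP.
exists (\matrix_(i, j) (0 < S k i j, S k i j < 0)).
rewrite NGA_norm1 (US_nga k).2 /g; congr (norm1 (_ *m PD (_ *m _))).
apply/matrixP => i j; rewrite !mxE /h /= (US_nga k).1 mxE sgr_gt0 sgr_lt0.
by case: sgrP; rewrite ?subr0 ?sub0r ?subrr.
Qed.

End Iteration.
End Matrices.

Theorem theorem3p3 (R : realType) (d n K : nat) (X : 'M[R]_(d, n))
  (PD : 'M[R]_(d, K) -> 'M[R]_(d, K))
  (U : nat -> 'M[R]_(d, K)) (S : nat -> 'M[R]_(n, K))
  (K_ge1 : (1 <= K)%N) (K_le_d : (K <= d)%N)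
  (PD_sel : PD_selection PD)
  (U0_St : stiefel d K (U 0%N))
  (US_nga : NGA PD X U S)
  (F0_gt0 : 0 < F X (U 0%N) (S 0%N)) :
  [/\ exists2 k0 : nat, (0 < k0)%N &
        forall (i : 'I_n) (j : 'I_K) (k : nat), (k0 <= k)%N ->
          ((col i X)^T *m col j (U k.+1)) 0 0 != 0 -> S k.+1 i j = S k i j,
      exists2 tau0 : R, 0 < tau0 &
        (exists2 k : nat, k%:Z <= Num.ceil (Fmax K X / tau0) &
           forall l : nat, (k <= l)%N -> F X (U l) (S l) = F X (U k) (S k)) /\
        (forall k : nat, F X (U k) (S k) <> F X (U k.+1) (S k.+1) ->
           F X (U k) (S k) + tau0 <= F X (U k.+1) (S k.+1))
    & forall k' : nat,
        F X (U k') (S k') = F X (U k'.+1) (S k'.+1) ->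
        (forall l : nat, (l < k')%N ->
           F X (U l) (S l) <> F X (U l.+1) (S l.+1)) ->
        FOC X (U k'.+1)].
Proof.
have stall := NGA_stall PD_sel U0_St US_nga.
have f_le := NGA_increasing PD_sel U0_St US_nga.
have [N NP] := NGA_stationary PD_sel U0_St US_nga.
have fN k : (N <= k)%N -> F X (U k) (S k) = F X (U k.+1) (S k.+1).
  by move=> Nk; rewrite !NP // ltnW.
split.
(* From [N] on every step stalls, so [S k] already carries the signs of [X^T *m U k.+1], which
   define [S k.+1]; the successor makes [k0] positive. *)
- exists N.+1 => // i j k Nk.
  have -> : ((col i X)^T *m col j (U k.+1)) 0 0 = (X^T *m U k.+1) i j.
    by rewrite !mxE; apply: eq_bigr => l _; rewrite !mxE.
  move=> V_neq0; rewrite (stall k _ i j V_neq0); last exact/fN/ltnW.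
  by rewrite (US_nga k.+1).1 mxE.
- have [t t_gt0 tP] := min_increment N f_le.
  have Fmax_gt0 : 0 < Fmax K X.
    apply: lt_le_trans F0_gt0 _; rewrite (NGA_norm1 US_nga).
    exact: (FmaxP X K_le_d).2.
  (* Once constant from step N on, shrinking tau0 below Fmax / (N + 1) makes
     the step bound ceil (Fmax / tau0) at least N. *)
  exists (Num.min t (Fmax K X / N.+1%:R)).
    by rewrite lt_min t_gt0 divr_gt0.
  set tau := Num.min _ _.
  have tau_gt0 : 0 < tau by rewrite lt_min t_gt0 divr_gt0.
  split=> [|k fk].
    exists N => //; rewrite -(ler_int R); apply: le_trans (ceil_ge _).
    rewrite ler_pdivlMr // -[(N%:Z)%:~R]/(N%:R).
    apply: (@le_trans _ _ (N.+1%:R * tau)).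
      by rewrite ler_pM2r // ler_nat.
    by rewrite mulrC -ler_pdivlMr // ge_min lexx orbT.
  have kN : (k < N)%N by rewrite ltnNge; apply/negP => /fN.
  by apply: le_trans (tP k kN fk); rewrite lerD2l ge_min lexx.
(* The old sign matrix [S k], rather than [S k.+1], is the certificate: [U k.+1] was built as a
   U-factor of [X *m S k]. *)
- move=> k /stall Sk _; exists (S k); last exact: NGA_U_factor.
  move=> i j; case: ifP => [/Sk//|_].
  by rewrite -ler_norml; exact: (NGA_sign_le1 US_nga).
Qed.
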